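(* Let $\mathbb{F}$ be an algebraically closed field of characteristic other than $2$, and let $\mathcal{A}$ be a finite-dimensional associative unital $\mathbb{F}$-algebra, with group of invertible elements $\mathcal{A}^\times$. Then, for every $x \in \mathcal{A}^\times$, the element $x$ is bireflectional in the group $(\mathcal{A}^\times,\times)$ if and only if $x$ is conjugated to its inverse in $\mathcal{A}^\times$, i.e. there exists $y \in \mathcal{A}^\times$ such that $yxy^{-1}=x^{-1}$.
   Context: An involution of a group $G$ is an element $a \in G$ with $a^2=1_G$ (the identity element is allowed). An element $g$ of a group $G$ is called bireflectional if $g=ab$ for some involutions $a,b$ of $G$. Algebras are associative with unity, and are not assumed commutative. *)

(* Defs.v *)
From HB Require Import structures.
From mathcomp Require Import all_boot all_order all_algebra all_field.

Set Implicit Arguments.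
Unset Strict Implicit.
Unset Printing Implicit Defensive.

Import GRing.Theory.
Local Open Scope ring_scope.

(* The library's {unit R} only covers finite rings; this is the analogous
   subtype of units for an arbitrary ring, as a groupType. *)
Record unit_group (R : unitRingType) := UnitGroup {
  unit_group_val :> R;
  unit_group_valP : unit_group_val \is a GRing.unit
}.

Bind Scope group_scope with unit_group.

Section UnitGroup.
Variable R : unitRingType.
Implicit Types u v w : unit_group R.

HB.instance Definition _ := [isSub for @unit_group_val R].
HB.instance Definition _ := [Choice of unit_group R by <:].

Definition unit_group_one : unit_group R := UnitGroup (unitr1 R).

Definition unit_group_inv u : unit_group R :=
  UnitGroup (etrans (unitrV (val u)) (valP u)).

Fact unit_group_mul_subproof u v : val u * val v \is a GRing.unit.
Proof. by rewrite unitrMr ?(valP u) ?(valP v). Qed.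

Definition unit_group_mul u v : unit_group R :=
  UnitGroup (unit_group_mul_subproof u v).

Fact unit_group_mulA : associative unit_group_mul.
Proof. by move=> u v w; apply/val_inj/mulrA. Qed.

Fact unit_group_mul1 : left_id unit_group_one unit_group_mul.
Proof. by move=> u; apply/val_inj/mul1r. Qed.

Fact unit_group_mulr1 : right_id unit_group_one unit_group_mul.
Proof. by move=> u; apply/val_inj/mulr1. Qed.

Fact unit_group_mulV : left_inverse unit_group_one unit_group_inv unit_group_mul.
Proof. by move=> u; apply/val_inj/mulVr/(valP u). Qed.

Fact unit_group_mulrV : right_inverse unit_group_one unit_group_inv unit_group_mul.
Proof. by move=> u; apply/val_inj/divrr/(valP u). Qed.

HB.instance Definition _ := isGroup.Build (unit_group R)
  unit_group_mulA unit_group_mul1 unit_group_mulr1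
  unit_group_mulV unit_group_mulrV.

Lemma val_unit_group1 : val (1%g : unit_group R) = 1.
Proof. by []. Qed.

Lemma val_unit_groupM u v : val (u * v)%g = val u * val v.
Proof. by []. Qed.

Lemma val_unit_groupV u : val (u^-1)%g = (val u)^-1.
Proof. by []. Qed.

End UnitGroup.

Definition involution (G : groupType) (a : G) : Prop := (a ^+ 2 = 1)%g.

Definition bireflectional (G : groupType) (g : G) : Prop :=
  exists a b : G, [/\ involution a, involution b & g = (a * b)%g].

(* Main.v *)
(* If y inverts x by conjugation, then y ^+ 2 commutes with x. Over an
   algebraically closed field of characteristic other than 2, the unit y ^+ 2
   has a square root s that is a polynomial in y ^+ 2, hence commutes with both
   x and y. Then a := y / s is an involution which still inverts x, so that
   a * x is an involution too, and x = a * (a * x). *)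
Require Import Defs.
From HB Require Import structures.
From mathcomp Require Import all_boot all_order all_algebra all_field.
From mathcomp Require Import ring.

Set Implicit Arguments.
Unset Strict Implicit.
Unset Printing Implicit Defensive.

Import GRing.Theory.
Local Open Scope ring_scope.

Lemma horner_algZ (R : nzSemiRingType) (A : semiAlgType R) (u : A) (c : R)
    (p : {poly R}) :
  horner_alg u (c *: p) = c *: horner_alg u p.
Proof. by rewrite -mul_polyC rmorphM /= horner_algC mulr_algl. Qed.

(** Evaluation at [u] sends the polynomials of size at most [(\dim {:A}).+1], a space of larger
    dimension than [A], linearly into [A], so its kernel is nonzero. *)
Lemma falg_annihilating_poly (F : fieldType) (A : falgType F) (u : A) :
  exists2 p : {poly F}, p != 0 & horner_alg u p = 0.
Proof.
pose n := (\dim {:A}).+1.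
pose f (v : 'rV[F]_n) : A := horner_alg u (rVpoly v).
have f_lin : linear f.
  by move=> c v w; rewrite /f linearP rmorphD /= horner_algZ.
pose fL : {linear 'rV[F]_n -> A} :=
  HB.pack f (GRing.isLinear.Build F _ _ _ f f_lin).
pose h := linfun fL.
have : lker h != 0%VS.
  rewrite -dimv_eq0 -lt0n -(ltn_add2r (\dim (limg h))) add0n.
  rewrite -[lker h]capfv limg_ker_dim dimvf /dim /= mul1n.
  exact: leq_ltn_trans (dimvS (subvf _)) _.
rewrite -vpick0 => nzv; exists (rVpoly (vpick (lker h))).
  by apply: contra_neq nzv => v0; rewrite -[LHS]rVpolyK v0 linear0.
by have := memv_pick (lker h); rewrite memv_ker lfunE => /eqP.
Qed.

(** The square root is lifted through one linear factor at a time, so repeated roots in [r] are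
    handled like distinct ones. *)
Lemma closed_field_sqrt_mod (F : closedFieldType) (r : seq F) :
    2%:R != 0 :> F -> all (predC1 0) r ->
  exists p q : {poly F}, p ^+ 2 - 'X = (\prod_(z <- r) ('X - z%:P)) * q.
Proof.
move=> nz2; elim: r => [|a r IHr] /=.
  by exists 0, (0 ^+ 2 - 'X); rewrite big_nil mul1r.
case/andP=> nza /IHr[p [q Dq]]; rewrite big_cons.
set m := \prod_(z <- r) _ in Dq *.
(* As in Hensel's lemma, p + c *: m is a square root of 'X modulo
   ('X - a%:P) * m as soon as c is a root of D. *)
pose D : {poly F} := Poly [:: q.[a]; 2%:R * p.[a]; m.[a]].
have [c /eqP Dc] : exists c, root D c.
  (* A rootless [D] is a nonzero constant, so [m] and [p] both vanish at [a]; evaluating [Dq] at [a]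
     then forces [a = 0]. *)
  apply/closed_rootP/negP => /size_poly1P[d nzd Dd].
  have := congr1 (fun P : {poly F} => P`_1) Dd; rewrite coef_Poly coefC /=.
  have := congr1 (fun P : {poly F} => P`_2) Dd; rewrite coef_Poly coefC /=.
  move=> ma0 /eqP; rewrite mulf_eq0 (negPf nz2) /= => /eqP pa0.
  have := congr1 (horner^~ a) Dq.
  rewrite /= !hornerE ma0 pa0 expr0n mul0r sub0r.
  by move/eqP; rewrite oppr_eq0 (negPf nza).
(* This is the cofactor of [m] in [(p + c *: m) ^+ 2 - 'X]; its value at [a] is [D.[c]]. *)
have: root (q + 2%:R * c *: p + c ^+ 2 *: m) a.
  by apply/eqP; rewrite !hornerE -[RHS]Dc horner_Poly /=; ring.
case/factor_theorem => q' Dq'; exists (p + c *: m), q'.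
rewrite -!mul_polyC polyCM polyC_exp polyC_natr in Dq' *.
have -> : (p + c%:P * m) ^+ 2 - 'X =
    (p ^+ 2 - 'X) + m * (2%:R * c%:P * p + c%:P ^+ 2 * m) by ring.
rewrite Dq -mulrDr.
transitivity (m * (q' * ('X - a%:P))); last by ring.
by rewrite -Dq'; ring.
Qed.

(** Some product of factors ['X - z%:P] with [z] nonzero kills [u], so a square root of ['X] modulo
    that product evaluates at [u] to a square root of [u]. *)
Lemma falg_unit_sqrt (F : closedFieldType) (A : falgType F) (u : A) :
    2%:R != 0 :> F -> u \is a GRing.unit ->
  exists p : {poly F}, horner_alg u p ^+ 2 = u.
Proof.
move=> nz2 Uu; have [m nzm] := falg_annihilating_poly u.
have [r Dm] := closed_field_poly_normal m.
rewrite Dm horner_algZ => /eqP; rewrite scaler_eq0 lead_coef_eq0 (negPf nzm) /=.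
(* The zero roots of m contribute a power of u, which can be cancelled. *)
rewrite (bigID (predC1 0)) /= rmorphM /= -big_filter.
rewrite [X in _ * horner_alg u X](eq_bigr (fun=> 'X)); last first.
  by move=> z /negbNE/eqP->; rewrite subr0.
rewrite big_const_seq iter_mulr_1 rmorphXn /= horner_algX.
move/eqP => um0; have r0 := mulIr (unitrX _ Uu) (etrans um0 (esym (mul0r _))).
have [p [q Dp]] := closed_field_sqrt_mod nz2 (filter_all (predC1 0) r).
exists p; apply/eqP; rewrite -subr_eq0 -{2}(horner_algX u) -rmorphXn -rmorphB /=.
by rewrite Dp rmorphM /= r0 mul0r.
Qed.

Lemma comm_horner_alg (R : nzSemiRingType) (A : semiAlgType R) (u v : A)
    (p : {poly R}) :
  GRing.comm v u -> GRing.comm v (horner_alg u p).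
Proof.
move=> vu; elim/poly_ind: p => [|p c IHp].
  by rewrite rmorph0; apply: commr0.
rewrite rmorphD rmorphM /= horner_algX horner_algC.
apply: commrD; first exact: commrM.
by rewrite /GRing.comm -scalerAl -scalerAr mul1r mulr1.
Qed.

Theorem theorem2 (F : closedFieldType) (hF : 2%N \notin [pchar F]%R)
    (A : falgType F) (x : unit_group A) :
  bireflectional x <-> (exists y : unit_group A, y * x * y^-1 = x^-1)%g.
Proof.
have nz2 : 2%:R != 0 :> F by move: hF; rewrite inE.
split=> [[a [b [a2 b2 ->]]] | [y yx]].
  have aV : (a^-1 = a)%g by apply: (mulgI a); rewrite mulgV -a2.
  have bV : (b^-1 = b)%g by apply: (mulgI b); rewrite mulgV -b2.
  (* Conjugation by [a] turns [a * b] into [b * a], which is its inverse. *)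
  by exists a; rewrite invgM aV bV !mulgA -expg2 a2 mul1g.
have [p Dp] := falg_unit_sqrt nz2 (valP (y * y)%g).
set s := horner_alg _ p in Dp.
have Us : s \is a GRing.unit.
  by rewrite -(unitrX_pos _ (ltn0Sn 1)) Dp (valP (y * y)%g).
pose w := UnitGroup Us.
have w2 : (w ^+ 2 = y ^+ 2)%g by apply: val_inj.
have cw (z : unit_group A) : commute z (y * y)%g -> commute z w.
  by move=> zy; apply/val_inj/comm_horner_alg/(congr1 val zy).
have wy : commute y w by apply: cw; rewrite /commute mulgA.
have yxV : (y * x = x^-1 * y)%g by rewrite -yx mulgVK.
have wx : commute x w.
  (* Using [x * y * x = y] twice, [x * y * y = x * y * x * y * x = y * y * x]. *)
  have yE : (x * (y * x) = y)%g by rewrite yxV mulgA mulgV mul1g.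
  by apply: cw; rewrite /commute -[RHS]mulgA -{3}yE -!mulgA yE.
pose a := (y / w)%g.
have a2 : involution a by rewrite /involution expgnFl // w2 mulgV.
have ax : (a * x = x^-1 * a)%g.
  by rewrite /a mulgA -yxV -!mulgA; congr (_ * _)%g; apply/esym/commuteV.
exists a, (a * x)%g; split=> //; last by rewrite mulgA -expg2 a2 mul1g.
by rewrite /involution expg2 {1}ax mulgA -[(_ * _ * a)%g]mulgA -expg2 a2
  mulg1 mulVg.
Qed.
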